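(* Let $\Gamma=\Gamma(V,E)$ be an infinite connected graph, let $s$ be a natural number such that $\rho(v)\leq s$ for all $v\in V$, let $(a_n)_{n\in\omega}$ be an arrow in $\Gamma$, and put $A=\{a_n : n\in\omega\}$. Then the following statements are equivalent: (i) $\Gamma$ is an asymptotic ray; (ii) there exists a natural number $r$ such that $V=B(A,r)$; (iii) the family $\{S(a_0,n): n\in\omega\}$ of subsets of $V$ is uniformly bounded in $\mathcal{B}(\Gamma)$.
   Context: Graphs are non-oriented, with set of vertices $V$ and set of edges $E$, edges being (unordered) pairs of distinct vertices. $\omega=\{0,1,2,\dots\}$. The degree $\rho(v)$ of a vertex $v$ is the number of edges incident to $v$. For a connected graph $\Gamma(V,E)$, $d$ denotes the path metric on $V$: $d(u,v)$ is the length of a shortest path from $u$ to $v$. For $v\in V$, a real $r\ge 0$, $k\in\omega$ and $A\subseteq V$ put $B(v,r)=\{u\in V: d(v,u)\leq r\}$, $B(A,r)=\bigcup_{a\in A}B(a,r)$, and $S(v,k)=\{u\in V: d(u,v)=k\}$. The ballean $\mathcal{B}(\Gamma)$ of a connected graph $\Gamma(V,E)$ is the triple $(V,\mathbb{R}^+,B)$, where $\mathbb{R}^+$ is the set of non-negative real numbers (the radii) and $B(v,r)$ are the balls above. For connected graphs $\Gamma_1(V_1,E_1)$, $\Gamma_2(V_2,E_2)$ with balls $B_1,B_2$, a mapping $f:V_1\to V_2$ is a $\prec$-mapping between $\mathcal{B}(\Gamma_1)$ and $\mathcal{B}(\Gamma_2)$ if for every $\alpha\in\mathbb{R}^+$ there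 exists $\beta\in\mathbb{R}^+$ such that $f(B_1(x,\alpha))\subseteq B_2(f(x),\beta)$ for all $x\in V_1$. A bijection $f:V_1\to V_2$ is an asymorphism between $\mathcal{B}(\Gamma_1)$ and $\mathcal{B}(\Gamma_2)$ if both $f$ and $f^{-1}$ are $\prec$-mappings; in that case the two balleans are called asymorphic. The ray $\mathcal{R}$ is the non-oriented graph with vertex set $\omega$ and edge set $\{(i,i+1): i\in\omega\}$. A connected graph $\Gamma$ is an asymptotic ray if $\mathcal{B}(\Gamma)$ and $\mathcal{B}(\mathcal{R})$ are asymorphic. An arrow in $\Gamma(V,E)$ (starting from $v_0$) is an injective sequence of vertices $(v_n)_{n\in\omega}$ such that $(v_i,v_{i+1})\in E$ and $v_i\in S(v_0,i)$ for all $i\in\omega$. A family $\mathfrak{F}$ of subsets of $V$ is uniformly bounded in $\mathcal{B}(\Gamma)$ if there exists $\alpha\in\mathbb{R}^+$ such that for every $F\in\mathfrak{F}$ there is some $x\in V$ with $F\subseteq B(x,\alpha)$. *)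

(* Defs.v *)
From mathcomp Require Import all_boot all_order all_algebra.
From mathcomp Require Import mathcomp_extra boolp classical_sets functions
  cardinality reals interval_inference.

Set Implicit Arguments.
Unset Strict Implicit.
Unset Printing Implicit Defensive.

Import Order.TTheory GRing.Theory Num.Theory.

Local Open Scope classical_set_scope.
Local Open Scope card_scope.
Local Open Scope ring_scope.

Record graph (V : Type) := Graph {
  edges : set (set V);
  edgesP : forall e, edges e -> exists u v, u <> v /\ e = [set u; v] }.

Definition adj (V : Type) (G : graph V) (u v : V) : Prop := edges G [set u; v].

(* [p] lists the vertices visited after [u]; hence [size p] is the number of
   edges. Repeated vertices are allowed, which does not affect shortest paths. *)
Definition is_path (V : Type) (G : graph V) (u : V) (p : seq V) (v : V) : Prop :=
  path (fun x y => `[< adj G x y >]) u p /\ last u p = v.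

Record connected_graph (V : Type) := ConnectedGraph {
  connected_graph_graph :> graph V;
  connectedP : forall u v, exists p, is_path connected_graph_graph u p v }.

Definition incident_edges (V : Type) (G : graph V) (v : V) : set (set V) :=
  [set e | edges G e /\ e v].

(* The degree is in general an infinite cardinal, so only the relation
   "the degree of [v] is at most [s]" is defined. *)
Definition degree_le (V : Type) (G : graph V) (v : V) (s : nat) : Prop :=
  incident_edges G v #<= `I_s.

Section PathMetric.
Variables (V : Type) (G : connected_graph V).

Definition path_length (u v : V) : pred nat :=
  fun n => `[< exists2 p, is_path G u p v & size p = n >].

Lemma path_length_ex (u v : V) : exists n, path_length u v n.
Proof.
by have [p up] := connectedP G u v; exists (size p); apply/asboolP; exists p.
Qed.

Definition dist (u v : V) : nat := ex_minn (path_length_ex u v).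

Definition sphere (v : V) (k : nat) : set V := [set u | dist u v = k].

Definition gball (R : realType) (v : V) (r : {nonneg R}) : set V :=
  [set u | (dist v u)%:R <= r%:num].

Definition gball_set (R : realType) (A : set V) (r : {nonneg R}) : set V :=
  \bigcup_(a in A) gball a r.

Definition arrow (a : nat -> V) : Prop :=
  injective a /\
  forall i, adj G (a i) (a i.+1) /\ sphere (a 0%N) i (a i).

End PathMetric.

Record ballean := Ballean {
  support : Type;
  radii : Type;
  ball_of : support -> radii -> set support }.

Definition graph_ballean (R : realType) (V : Type) (G : connected_graph V) :
  ballean := @Ballean V {nonneg R} (@gball V G R).

Definition prec_mapping (B1 B2 : ballean) (f : support B1 -> support B2) :
    Prop :=
  forall alpha : radii B1, exists beta : radii B2,
    forall x, f @` ball_of x alpha `<=` ball_of (f x) beta.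

Definition asymorphism (B1 B2 : ballean) (f : support B1 -> support B2) :
    Prop :=
  exists g : support B2 -> support B1,
    [/\ cancel f g, cancel g f, prec_mapping f & prec_mapping g].

Definition asymorphic (B1 B2 : ballean) : Prop :=
  exists f : support B1 -> support B2, asymorphism f.

Definition uniformly_bounded (B : ballean) (F : set (set (support B))) : Prop :=
  exists alpha : radii B, forall S, F S -> exists x, S `<=` ball_of x alpha.

Lemma ray_edgesP (e : set nat) : (exists i, e = [set i; i.+1]) ->
  exists u v : nat, u <> v /\ e = [set u; v].
Proof. by move=> [i ->]; exists i, i.+1; split => // /n_Sn. Qed.

Definition ray_graph : graph nat :=
  @Graph nat [set e | exists i, e = [set i; i.+1]] ray_edgesP.

Lemma ray_adjS (i : nat) : adj ray_graph i i.+1.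
Proof. by exists i. Qed.

Lemma ray_adj_pred (i : nat) : adj ray_graph i.+1 i.
Proof. by exists i; rewrite setUC. Qed.

Lemma ray_connected (u v : nat) : exists p, is_path ray_graph u p v.
Proof.
have up n : exists p, is_path ray_graph 0%N p n.
  elim: n => [|n [p [pp lp]]]; first by exists [::].
  exists (rcons p n.+1); split; last by rewrite last_rcons.
  by rewrite rcons_path pp lp; apply/asboolP/ray_adjS.
elim: u => [|u [p [pp lp]]]; first exact: up.
by exists (u :: p); split => //=; rewrite pp andbT; apply/asboolP/ray_adj_pred.
Qed.

Definition ray : connected_graph nat := ConnectedGraph ray_connected.

Definition asymptotic_ray (R : realType) (V : Type) (G : connected_graph V) :
  Prop := asymorphic (graph_ballean R G) (graph_ballean R ray).

(* Main.v *)
(* (i) => (ii): an asymorphism f onto the ray moves by at most a constant along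
   each edge of the arrow, and it is unbounded on the arrow by injectivity; so
   f(A) comes within a bounded distance of every natural number, and pulling
   back along f^-1 shows that A is within a bounded distance of every vertex.
   (ii) => (iii): a vertex of S(a_0, n) within distance r of a_i satisfies
   |i - n| <= r, hence lies within 2r of a_n.
   (iii) => (i): by the degree bound, the spheres S(a_0, n) have between 1 and M
   elements. Number the vertices sphere after sphere: differences of numbers and
   differences of levels d(a_0, x) then bound each other up to affine factors,
   and the level n determines x up to a bounded distance from a_n. *)

Require Import Defs.
From mathcomp Require Import all_boot all_order all_algebra zify.
From mathcomp Require Import mathcomp_extra boolp classical_sets functions
  cardinality reals interval_inference.

Set Implicit Arguments.
Unset Strict Implicit.
Unset Printing Implicit Defensive.

Import Order.TTheory GRing.Theory Num.Theory.

Local Open Scope classical_set_scope.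
Local Open Scope ring_scope.

(** * Walks and the path metric *)

Lemma adjC (V : Type) (G : graph V) (u v : V) : adj G u v -> adj G v u.
Proof. by rewrite /adj setUC. Qed.

Lemma lipschitz_path (V : Type) (G : graph V) (h : V -> nat) (b : nat) :
    (forall x y, adj G x y -> (h y <= h x + b)%N) ->
  forall u p v, is_path G u p v -> (h v <= h u + b * size p)%N.
Proof.
move=> h_lip u p v [+ <-] {v}; elim: p u => [|x p IHp] u /=; first by lia.
by move=> /andP[/asboolP/h_lip hux /IHp]; nia.
Qed.

Section DistTheory.
Variables (V : Type) (G : connected_graph V).
Implicit Types (u v w : V) (n : nat).

Lemma dist_path u v : exists2 p, is_path G u p v & size p = dist G u v.
Proof. by rewrite /dist; case: ex_minnP => n /asboolP. Qed.

Lemma dist_le_size u p v : is_path G u p v -> (dist G u v <= size p)%N.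
Proof.
move=> uv; rewrite /dist; case: ex_minnP => n _; apply.
by apply/asboolP; exists p.
Qed.

Lemma distxx u : dist G u u = 0%N.
Proof. by apply/eqP; rewrite -leqn0; apply: (@dist_le_size u [::]). Qed.

Lemma adj_dist_le1 u v : adj G u v -> (dist G u v <= 1)%N.
Proof.
move=> uv; apply: (@dist_le_size u [:: v]); split=> //=.
by rewrite andbT; apply/asboolP.
Qed.

Lemma dist_triangle v u w : (dist G u w <= dist G u v + dist G v w)%N.
Proof.
have [p [up pv] <-] := dist_path u v; have [q [vq qw] <-] := dist_path v w.
rewrite -size_cat; apply: dist_le_size; split.
  by rewrite cat_path up pv.
by rewrite last_cat pv.
Qed.

Lemma lipschitz_dist (h : V -> nat) (b : nat) :
    (forall x y, adj G x y -> (h y <= h x + b)%N) ->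
  forall u v, (h v <= h u + b * dist G u v)%N.
Proof.
by move=> h_lip u v; have [p + <-] := dist_path u v; apply: lipschitz_path.
Qed.

Lemma dist_sym u v : dist G u v = dist G v u.
Proof.
suff dist_le x y : (dist G x y <= dist G y x)%N.
  by apply/eqP; rewrite eqn_leq !dist_le.
(* The distance to [y] vanishes at [y] and grows by at most 1 along each edge, so no path has to be
   reversed. *)
have := @lipschitz_dist (dist G ^~ y) 1 _ y x; rewrite distxx mul1n; apply.
move=> z w zw; apply: leq_trans (dist_triangle z w y) _.
by rewrite addnC leq_add2l; apply/adj_dist_le1/adjC.
Qed.

(** One of the two truncated differences is zero, so the bound is |i - j|. *)
Lemma dist_walk (a : nat -> V) : (forall i, adj G (a i) (a i.+1)) ->
  forall i j, (dist G (a i) (a j) <= (i - j) + (j - i))%N.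
Proof.
move=> a_adj.
have dist_up i n : (dist G (a i) (a (i + n)%N) <= n)%N.
  elim: n => [|n IHn]; first by rewrite addn0 distxx.
  rewrite addnS; apply: leq_trans (dist_triangle (a (i + n)%N) _ _) _.
  by have := adj_dist_le1 (a_adj (i + n)%N); lia.
move=> i j; have [ij|/ltnW ji] := leqP i j.
  by have := dist_up i (j - i)%N; rewrite subnKC //; lia.
by have := dist_up j (i - j)%N; rewrite subnKC // dist_sym; lia.
Qed.

(** Distances are integers, so a real radius may be replaced by its integer part. *)
Lemma gballE (R : realType) v (r : {nonneg R}) u :
  gball G v r u <-> (dist G v u <= Num.truncn r%:num)%N.
Proof. by rewrite truncn_ge_nat. Qed.

End DistTheory.

(** * Mappings of graph balleans through integer bounds, and the metric of the ray *)

Lemma prec_mapping_graphP (R : realType) (V W : Type) (G : connected_graph V)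
    (H : connected_graph W) (f : V -> W) :
  @prec_mapping (graph_ballean R G) (graph_ballean R H) f <->
  forall n, exists m, forall x y,
    (dist G x y <= n)%N -> (dist H (f x) (f y) <= m)%N.
Proof.
split=> [f_prec n|f_bound alpha].
  have [beta fB] := f_prec (n%:R : R)%:nng.
  exists (Num.truncn beta%:num) => x y xy; apply/gballE/(fB x).
  by exists y => //; apply/gballE; rewrite /= natrK.
have [m fm] := f_bound (Num.truncn alpha%:num).
exists (m%:R : R)%:nng => x _ [y /gballE xy <-].
by apply/gballE; rewrite /= natrK; apply: fm.
Qed.

Lemma dist_ray (i j : nat) : dist ray i j = ((i - j) + (j - i))%N.
Proof.
apply/eqP; rewrite eqn_leq (@dist_walk _ ray id ray_adjS) /=.
have ray_lip (x y : nat) : adj ray x y -> (y <= x + 1)%N.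
  move=> [k xyk].
  have : [set x; y] x by left.
  have : [set x; y] y by right.
  by rewrite xyk => -[->|->] [->|->] /=; lia.
have := @lipschitz_dist _ ray id 1 ray_lip i j.
have := @lipschitz_dist _ ray id 1 ray_lip j i.
by rewrite (dist_sym ray j i) /=; lia.
Qed.

(** * Finite balls from the degree bound *)

Lemma neighbors_seq (V : choiceType) (G : graph V) (s : nat) (v : V) :
    degree_le G v s ->
  exists2 N : seq V, (size N <= s)%N & forall u, adj G v u -> u \in N.
Proof.
move=> /pfcard_geP[no_edge|[e]].
  exists [::] => // u uv; suff : (set0 : set (set V)) [set v; u] by [].
  by rewrite -no_edge; split=> //; left.
(* The other end of an edge at [v]. On sets not of the form {v, u} the default [v] merely adds a
   harmless entry to the list. *)
pose end_of (S : set V) : V := xget v [set u | S = [set v; u]].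
exists [seq end_of (e i) | i <- iota 0 s]; first by rewrite size_map size_iota.
move=> u uv.
have [i /= i_s eE] : (e @` `I_s) [set v; u].
  by apply: (@surj _ _ _ _ e); split=> //; left.
apply/mapP; exists i; first by rewrite mem_iota.
rewrite eE /end_of; case: xgetP => [w _ /= vuw|/(_ u) []//].
have : [set v; w] u by rewrite -vuw; right.
case=> // uv_eq; have : [set v; u] w by rewrite vuw; right.
by case=> ->.
Qed.

(** Induction on the length of walks: a walk from [v] is empty or continues from one of at most [s]
    neighbors, whence the recursion [(s * M).+1]. *)
Lemma bounded_degree_ball (V : choiceType) (G : connected_graph V) (s : nat) :
    (forall v, degree_le G v s) ->
  forall n, exists M, forall v, exists2 B : seq V,
    (size B <= M)%N & forall u, (dist G v u <= n)%N -> u \in B.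
Proof.
move=> G_deg n.
suff [M HM] : exists M, forall v, exists2 B : seq V, (size B <= M)%N &
    forall p u, (size p <= n)%N -> is_path G v p u -> u \in B.
  exists M => v; have [B sB inB] := HM v; exists B => // u.
  by have [p vu <-] := dist_path G v u => /inB; apply.
elim: n => [|n [M IHM]].
  exists 1%N => v; exists [:: v] => // -[|//] u _ [_ <-].
  exact: mem_head.
have /choice[C HC] : forall v, exists B : seq V, (size B <= M)%N /\
    forall p u, (size p <= n)%N -> is_path G v p u -> u \in B.
  by move=> v; have [B] := IHM v; exists B.
exists (s * M).+1 => v; have [N sN inN] := neighbors_seq (G_deg v).
exists (v :: flatten [seq C w | w <- N]).
  rewrite [size _]/= ltnS (leq_trans _ (leq_mul sN (leqnn M)))//.
  elim: N {sN inN} => [//|w N IHN]; rewrite /= size_cat mulSn leq_add //.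
  by have [] := HC w.
case=> [|w p] u; first by move=> _ [_ <-]; apply: mem_head.
rewrite ltnS => sp [/= /andP[/asboolP vw wp] pu].
rewrite in_cons; apply/orP; right; apply/flatten_mapP.
by exists w; [apply: inN | apply: (proj2 (HC w) p)].
Qed.

(** * Enumeration of a set cut into nonempty finite layers of bounded size *)

Section LayeredEnumeration.
Variables (T : choiceType) (x0 : T) (h : T -> nat) (M : nat) (L : nat -> seq T).
Hypothesis L_uniq : forall n, uniq (L n).
Hypothesis mem_L : forall n x, (x \in L n) = (h x == n).
Hypothesis size_L : forall n, (0 < size (L n) <= M)%N.

Fixpoint layers (n : nat) : seq T :=
  if n is m.+1 then layers m ++ L m else [::].

Lemma mem_layers n x : (x \in layers n) = (h x < n)%N.
Proof. by elim: n => [//|n IHn] /=; rewrite mem_cat IHn mem_L; lia. Qed.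

Lemma layers_uniq n : uniq (layers n).
Proof.
elim: n => [//|n IHn] /=; rewrite cat_uniq IHn L_uniq andbT /=.
by apply/hasPn => x; rewrite mem_L mem_layers; lia.
Qed.

Lemma layers_cat m n : (m <= n)%N -> exists t, layers n = layers m ++ t.
Proof.
elim: n => [|n IHn]; first by case: m => //; exists [::].
rewrite leq_eqVlt => /predU1P[->|]; first by exists [::]; rewrite cats0.
by rewrite ltnS => /IHn[t /= ->]; exists (t ++ L n); rewrite catA.
Qed.

(** Each of the [n - m] added layers has between 1 and [M] elements. *)
Lemma size_layers m n : (m <= n)%N ->
  (size (layers m) + (n - m) <= size (layers n)
     <= size (layers m) + M * (n - m))%N.
Proof.
elim: n => [|n IHn]; first by case: m => //=; rewrite muln0.
rewrite leq_eqVlt => /predU1P[->|]; first by rewrite subnn muln0 addn0 leqnn.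
rewrite ltnS => mn; have := IHn mn; have := size_L n.
by rewrite /= size_cat subSn // mulnS; lia.
Qed.

Lemma size_layers_ge n : (n <= size (layers n))%N.
Proof. by have := size_layers (leq0n n); rewrite /= subn0; lia. Qed.

Definition layer_rank (x : T) : nat := index x (layers (h x).+1).

(** As no layer is empty, [layers k.+1] has more than [k] entries, so the default [x0] is never
    returned. *)
Definition layer_unrank (k : nat) : T := nth x0 (layers k.+1) k.

(* [layers m] is a prefix of [layers n] for [m <= n], so any large enough [n]
   yields the same rank. *)
Lemma layer_rankE n x : (h x < n)%N -> index x (layers n) = layer_rank x.
Proof.
by move=> /layers_cat[t ->]; rewrite index_cat mem_layers ltnSn.
Qed.

Lemma layer_unrankE n k : (k < n)%N -> nth x0 (layers n) k = layer_unrank k.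
Proof. by move=> /layers_cat[t ->]; rewrite nth_cat size_layers_ge. Qed.

Lemma layer_rankK : cancel layer_rank layer_unrank.
Proof.
(* For this [n], rank and unrank are both read off the single list [layers n], where [index] and
   [nth] are inverse. *)
move=> x; set n := maxn (h x).+1 (layer_rank x).+1.
have xn : (h x < n)%N by rewrite leq_max ltnSn.
rewrite -(@layer_unrankE n) ?leq_max ?ltnSn ?orbT//.
by rewrite -(layer_rankE xn) nth_index // mem_layers.
Qed.

Lemma layer_unrankK : cancel layer_unrank layer_rank.
Proof.
move=> k; set n := maxn (h (layer_unrank k)).+1 k.+1.
have kn : (k < n)%N by rewrite leq_max ltnSn orbT.
rewrite -(@layer_rankE n) ?leq_max ?ltnSn//.
rewrite -(layer_unrankE kn) index_uniq ?layers_uniq//.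
by rewrite (leq_trans kn)// size_layers_ge.
Qed.

Lemma layer_rank_bounds x :
  (size (layers (h x)) <= layer_rank x < size (layers (h x).+1))%N.
Proof.
rewrite /layer_rank index_mem mem_layers ltnSn andbT /= index_cat mem_layers.
by rewrite ltnn leq_addr.
Qed.

(** From the start of the layer of [x] to the end of that of [y] there are at most [n.+1] layers,
    both ends included. *)
Lemma layer_rank_lipschitz x y n : (h y <= h x + n)%N ->
  (layer_rank y <= layer_rank x + M * n.+1)%N.
Proof.
move=> yx; have := layer_rank_bounds x; have := layer_rank_bounds y.
have [xy|yx'] := leqP (h x) (h y).+1.
  have := size_layers xy.
  have : (M * ((h y).+1 - h x) <= M * n.+1)%N.
    by rewrite leq_mul2l; apply/orP; right; lia.
  by lia.
by have := size_layers (ltnW yx'); lia.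
Qed.

(** If [h x < h y], each layer strictly between contributes at least one rank; the strict upper
    bound on the rank of [x] supplies the missing unit. *)
Lemma layer_le_rank x y : (h y <= h x + (layer_rank y - layer_rank x))%N.
Proof.
have := layer_rank_bounds x; have := layer_rank_bounds y.
have [//|xy] := leqP (h y) (h x); first by lia.
by have := size_layers xy; lia.
Qed.

End LayeredEnumeration.

(** * The implications between the three statements *)

Lemma asymptotic_ray_layers (R : realType) (V : choiceType)
    (G : connected_graph V) (s : nat) (a : nat -> V) :
    (forall v, degree_le G v s) -> arrow G a ->
    @uniformly_bounded (graph_ballean R G) (range (sphere G (a 0%N))) ->
  asymptotic_ray R G.
Proof.
move=> G_deg [_ a_arrow] [alpha S_alpha].
pose h x := dist G x (a 0%N); pose r := Num.truncn alpha%:num.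
have ha n : h (a n) = n by exact: (proj2 (a_arrow n)).
have h_lip x y : (h y <= h x + dist G x y)%N.
  by rewrite addnC (dist_sym G x y); apply: dist_triangle.
have layer_diam x y : h x = h y -> (dist G x y <= r + r)%N.
  move=> xy.
  have [z Sz] : exists z, sphere G (a 0%N) (h y) `<=` gball G z alpha.
    by apply: S_alpha; exists (h y).
  have /gballE zx := Sz x xy; have /gballE zy := Sz y erefl.
  by apply: leq_trans (dist_triangle G z x y) _; rewrite dist_sym leq_add.
have [M ballM] := bounded_degree_ball G_deg (r + r)%N.
have /choice[L HL] : forall n, exists B : seq V,
    [/\ uniq B, forall x, (x \in B) = (h x == n) & (0 < size B <= M)%N].
  move=> n; have [B sB inB] := ballM (a n).
  (* By [layer_diam], the whole level [n] lies in the ball of radius [r + r] around [a n]; [a n]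
     itself makes it nonempty. *)
  exists (undup [seq x <- B | h x == n]).
  have memL x : (x \in undup [seq x <- B | h x == n]) = (h x == n).
    rewrite mem_undup mem_filter andb_idr // => /eqP hx.
    by apply/inB/layer_diam; rewrite ha hx.
  split=> //; first exact: undup_uniq.
  rewrite (leq_trans (size_undup _)) ?size_filter
    ?(leq_trans (count_size _ _))//.
  by rewrite andbT -has_predT; apply/hasP; exists (a n) => //; rewrite memL ha.
have L_uniq n : uniq (L n) by have [] := HL n.
have mem_L n x : (x \in L n) = (h x == n) by have [] := HL n.
have size_L n : (0 < size (L n) <= M)%N by have [] := HL n.
pose f : V -> nat := layer_rank h L.
pose g : nat -> V := layer_unrank (a 0%N) L.
have fK : cancel f g := layer_rankK (a 0%N) mem_L size_L.
have gK : cancel g f := layer_unrankK (a 0%N) L_uniq mem_L size_L.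
exists f, g; split=> //.
  apply/(prec_mapping_graphP R G ray) => n.
  exists (M * n.+1 + M * n.+1)%N => x y xy; rewrite dist_ray.
  have f_lip u v : (dist G u v <= n)%N -> (f v <= f u + M * n.+1)%N.
    move=> uv; apply: (layer_rank_lipschitz mem_L size_L).
    exact: leq_trans (h_lip u v) (leq_add (leqnn _) uv).
  have := f_lip _ _ xy; rewrite dist_sym in xy.
  by have := f_lip _ _ xy; lia.
apply/(prec_mapping_graphP R ray G) => n.
(* Route from [g i] to [g j]: within its level to the arrow, at most [n] steps along the arrow, then
   within the level of [g j]. *)
exists ((r + r) + (n + (r + r)))%N => i j; rewrite dist_ray => ij.
have hij := layer_le_rank mem_L size_L (g i) (g j).
have hji := layer_le_rank mem_L size_L (g j) (g i).
rewrite -/(f (g i)) -/(f (g j)) !gK in hij hji.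
apply: leq_trans (dist_triangle G (a (h (g i))) _ _) _.
apply: leq_add; first by rewrite layer_diam // ha.
apply: leq_trans (dist_triangle G (a (h (g j))) _ _) _.
apply: leq_add; last by rewrite layer_diam // ha.
apply: leq_trans (dist_walk (fun i => proj1 (a_arrow i)) _ _) _.
rewrite /h in hij hji *; lia.
Qed.

(** Pigeonhole: otherwise ['I_k.+1] would inject into ['I_k]. *)
Lemma injective_nat_unbounded (k : nat) (f : nat -> nat) :
  injective f -> exists n, (k <= f n)%N.
Proof.
move=> f_inj; apply: contrapT => /forallNP f_lt.
have fk n : (f n < k)%N by rewrite ltnNge; apply/negP/f_lt.
have : injective (fun i : 'I_k.+1 => Ordinal (fk i)).
  by move=> i j [/f_inj/val_inj].
by move=> /leq_card; rewrite !card_ord ltnn.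
Qed.

Lemma ray_arrow_dense (R : realType) (V : Type) (G : connected_graph V)
    (a : nat -> V) :
  arrow G a -> asymptotic_ray R G ->
  exists r : nat, [set: V] = gball_set G (range a) (r%:R : R)%:nng.
Proof.
move=> [a_inj a_arrow] [f [g [fK gK]]].
move=> /(prec_mapping_graphP R G ray) f_prec.
move=> /(prec_mapping_graphP R ray G) g_prec.
have [b fb] := f_prec 1%N.
have fa_lip i : (f (a i.+1) <= f (a i) + b)%N.
  have := fb _ _ (adj_dist_le1 (proj1 (a_arrow i))); rewrite dist_ray; lia.
pose c := f (a 0%N).
(* Descend from an index where [f \o a] is at least [k]. Either a step crosses [k], and its length
   is at most [b], or index 0 is reached with [k <= c], at distance at most [c]. *)
have fa_dense k : exists i, (dist ray (f (a i)) k <= b + c)%N.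
  have /(injective_nat_unbounded k) : injective (f \o a).
    exact/inj_comp/a_inj/(can_inj fK).
  elim=> n; elim: n => [|n IHn] /= kn.
    by exists 0%N; rewrite dist_ray -/c in kn *; lia.
  have [/IHn//|nk] := leqP k (f (a n)).
  by exists n.+1; rewrite dist_ray; have := fa_lip n; lia.
have [r gr] := g_prec (b + c)%N.
exists r; apply/seteqP; split=> // v _.
have [i /gr] := fa_dense (f v); rewrite !fK => iv.
by exists (a i); [exists i | apply/gballE; rewrite /= natrK].
Qed.

Lemma arrow_dense_spheres_bounded (R : realType) (V : Type)
    (G : connected_graph V) (a : nat -> V) (r : nat) :
  arrow G a -> [set: V] = gball_set G (range a) (r%:R : R)%:nng ->
  @uniformly_bounded (graph_ballean R G) (range (sphere G (a 0%N))).
Proof.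
move=> [_ a_arrow] a_dense; exists ((r + r)%:R : R)%:nng => _ [n _ <-].
exists (a n) => x xn; apply/gballE; rewrite /= natrK.
have [_ [i _ <-] /gballE] : gball_set G (range a) (r%:R : R)%:nng x.
  by rewrite -a_dense.
rewrite /= natrK => ix.
apply: leq_trans (dist_triangle G (a i) _ _) _; apply: (leq_add _ ix).
apply: leq_trans (dist_walk (fun i => proj1 (a_arrow i)) _ _) _.
have [_ /= ia] := a_arrow i; rewrite /sphere /= in xn ia.
have := dist_triangle G (a i) x (a 0%N).
have := dist_triangle G x (a i) (a 0%N).
by rewrite (dist_sym G x (a i)) xn ia; lia.
Qed.

Theorem theorem1 (R : realType) (V : Type) (G : connected_graph V)
  (V_infinite : infinite_set [set: V])
  (s : nat) (degree_bound : forall v : V, degree_le G v s)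
  (a : nat -> V) (a_arrow : arrow G a) :
  [<-> asymptotic_ray R G;
       exists r : nat, [set: V] = gball_set G (range a) (r%:R : R)%:nng;
       @uniformly_bounded (graph_ballean R G) (range (sphere G (a 0%N)))].
Proof.
tfae.
- exact: ray_arrow_dense.
- by move=> [r]; apply: arrow_dense_spheres_bounded.
(* [{classic V}] equips [V] with the choice and decidable equality that the lists of vertices
   require. *)
- exact: (@asymptotic_ray_layers R {classic V} G s).
Qed.
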